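(* Consider the problem of minimizing $F(\mathbf{x})+G(\mathbf{y})$ subject to $x_{\mathcal{C}_l}-y_l=0$ for all $l\in\mathcal{Q}_\mathcal{G}$ (so $q_l=p_l=|\mathcal{C}_l|d$). Let $\alpha_i,\beta_i,\gamma_i,\phi_i>0$ for $i\in\mathcal{N}$, and let $(\mathbf{x}^k,\mathbf{y}^k,\mathbf{u}^k)_{k\ge0}$ be generated, from arbitrary initial values, by the agent-wise-parameter version of the CL-ADMM algorithm or of the CL-FLiP-ADMM algorithm described in the context. Assume: (a) for every $i\in\mathcal{N}$, $f_i:\mathbb{R}^d\to\mathbb{R}\cup\{+\infty\}$ is proper, closed and convex, and in the decomposition $f_i=f_i^1+f_i^2$ the function $f_i^1$ is proper, closed and convex and $f_i^2:\mathbb{R}^d\to\mathbb{R}$ is convex and differentiable with $L_{f_i^2}$-Lipschitz continuous gradient for some $L_{f_i^2}\ge0$; (b) for every $l\in\mathcal{Q}_\mathcal{G}$, $g_l:\mathbb{R}^{q_l}\to\mathbb{R}\cup\{+\infty\}$ is proper, closed and convex, and in the decomposition $g_l=g_l^1+g_l^2$ the function $g_l^1$ is proper, closed and convex and $g_l^2:\mathbb{R}^{q_l}\to\mathbb{R}$ is convex and differentiable with $L_{g_l^2}$-Lipschitz continuous gradient for some $L_{g_l^2}\ge0$; (c) the Lagrangian $\mathcal{L}$ has a saddle point $(\mathbf{x}^*,\mathbf{y}^*,\mathbf{u}^* )$. Assume moreover that for all $i\in\mathcal{N}$ and some $\varepsilon_i\in(0,2-\phi_i)$, $$\alpha_i^{-1}\ge\gamma_i|\mathcal{Q}_\mathcal{G}^i|+L_{f_i^2},\qquad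 \beta_i^{-1}-\gamma_i\ge0,$$ $$\gamma_i\Bigl(1-\frac{(1-\phi_i)^2}{2-\phi_i-\varepsilon_i}\Bigr)I_d+Q_i\succeq 3\Bigl(\max_{l\in\mathcal{Q}_\mathcal{G}^i}L_{g_l^2}\Bigr)I_d,$$ where $Q_i=(\beta_i^{-1}-\gamma_i)I_d$. Then $$\lim_{k\to\infty}\bigl(F(\mathbf{x}^k)+G(\mathbf{y}^k)\bigr)=F(\mathbf{x}^* )+G(\mathbf{y}^* ),\qquad\lim_{k\to\infty}(\mathbf{W}\mathbf{x}^k-\mathbf{y}^k)=0.$$
   Context: Graph. $\mathcal{G}=(\mathcal{N},\mathcal{E})$ is an undirected graph with $\mathcal{N}=\{1,\dots,n\}$. A set $\mathcal{C}\subset\mathcal{N}$ is a clique if the induced subgraph on $\mathcal{C}$ is complete (cliques need not be maximal). $\bar{\mathcal{Q}}_\mathcal{G}=\{1,\dots,q\}$ indexes all cliques $\mathcal{C}_1,\dots,\mathcal{C}_q$ of $\mathcal{G}$; $\mathcal{Q}_\mathcal{G}\subset\bar{\mathcal{Q}}_\mathcal{G}$ is a fixed subset; $\mathcal{Q}_\mathcal{G}^i=\{l\in\mathcal{Q}_\mathcal{G}: i\in\mathcal{C}_l\}$. A maximum over an empty index set is read as $0$. Notation. For $\mathbf{x}=[x_1^\top,\dots,x_n^\top]^\top\in\mathbb{R}^{nd}$ with $x_i\in\mathbb{R}^d$, and $\mathcal{C}=\{j_1<\dots<j_{|\mathcal{C}|}\}$, $x_\mathcal{C}=[x_{j_1}^\top,\dots,x_{j_{|\mathcal{C}|}}^\top]^\top$;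 likewise, for $a\in\mathbb{R}^n$, $a_\mathcal{C}=[a_{j_1},\dots,a_{j_{|\mathcal{C}|}}]^\top$. The bijection $\pi_l:\mathcal{C}_l\to\{1,\dots,|\mathcal{C}_l|\}$ sends the $j$-th smallest element of $\mathcal{C}_l$ to $j$. For a vector $v$ made of blocks in $\mathbb{R}^d$, $[v]_j$ is its $j$-th block. For symmetric positive definite $M$, $\|v\|_M^2=v^\top Mv$ and $\mathrm{prox}^M_g(x)=\arg\min_y\{g(y)+\frac12\|x-y\|_M^2\}$; $\mathrm{prox}_g=\mathrm{prox}_g^{I}$. $F(\mathbf{x})=\sum_{i\in\mathcal{N}}f_i(x_i)$, $G(\mathbf{y})=\sum_{l\in\mathcal{Q}_\mathcal{G}}g_l(y_l)$, where $\mathbf{y}$ (and $\mathbf{u}$) stacks $y_l$ (resp. $u_l$) $\in\mathbb{R}^{|\mathcal{C}_l|d}$ over $l\in\mathcal{Q}_\mathcal{G}$. $\mathbf{W}$ stacks vertically the matrices $W_l$, $l\in\mathcal{Q}_\mathcal{G}$, defined by $W_l\mathbf{x}=x_{\mathcal{C}_l}$ for all $\mathbf{x}$. The Lagrangian is $\mathcal{L}(\mathbf{x},\mathbf{y},\mathbf{u})=F(\mathbf{x})+G(\mathbf{y})+\langle\mathbf{u},\mathbf{W}\mathbf{x}-\mathbf{y}\rangle$; a saddle point minimizes over $(\mathbf{x},\mathbf{y})$ and maximizes over $\mathbf{u}$. CL-FLiP-ADMM with agent-wise parameters. Put $\gamma=[\gamma_1,\dots,\gamma_n]^\top$, $\phi=[\phi_1,\dots,\phi_n]^\top$,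 $\beta=[\beta_1,\dots,\beta_n]^\top$, and for $l\in\mathcal{Q}_\mathcal{G}$ put $\Gamma_l=\mathrm{diag}(\gamma_{\mathcal{C}_l})\otimes I_d$, $\Phi_l=\mathrm{diag}(\phi_{\mathcal{C}_l})\otimes I_d$, $D_l=\mathrm{diag}(\beta_{\mathcal{C}_l})\otimes I_d$. For $k=0,1,\dots$, for all $i\in\mathcal{N}$ and then all $l\in\mathcal{Q}_\mathcal{G}$: $$x_i^{k+1}=\mathrm{prox}_{\alpha_i f_i^1}\Bigl(x_i^k-\alpha_i\Bigl(\nabla f_i^2(x_i^k)+\sum_{l\in\mathcal{Q}_\mathcal{G}^i}\bigl[u_l^k+\Gamma_l(x_{\mathcal{C}_l}^k-y_l^k)\bigr]_{\pi_l(i)}\Bigr)\Bigr),$$ $$y_l^{k+1}=\mathrm{prox}_{g_l^1}^{D_l^{-1}}\Bigl(y_l^k-D_l\bigl(\nabla g_l^2(y_l^k)-u_l^k-\Gamma_l(x_{\mathcal{C}_l}^{k+1}-y_l^k)\bigr)\Bigr),$$ $$u_l^{k+1}=u_l^k+\Phi_l\Gamma_l(x_{\mathcal{C}_l}^{k+1}-y_l^{k+1}).$$ CL-ADMM with agent-wise parameters. The special case $f_i^2=0$, $g_l^2=0$ of CL-FLiP-ADMM with agent-wise parameters, i.e. $f_i^1=f_i$, $g_l^1=g_l$, $L_{f_i^2}=L_{g_l^2}=0$. Explicitly, with the same $\Gamma_l=\mathrm{diag}(\gamma_{\mathcal{C}_l})\otimes I_d$, $\Phi_l=\mathrm{diag}(\phi_{\mathcal{C}_l})\otimes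 I_d$, $D_l=\mathrm{diag}(\beta_{\mathcal{C}_l})\otimes I_d$, for $k=0,1,\dots$, for all $i\in\mathcal{N}$ and then all $l\in\mathcal{Q}_\mathcal{G}$: $$x_i^{k+1}=\mathrm{prox}_{\alpha_i f_i}\Bigl(x_i^k-\alpha_i\sum_{l\in\mathcal{Q}_\mathcal{G}^i}\bigl[u_l^k+\Gamma_l(x_{\mathcal{C}_l}^k-y_l^k)\bigr]_{\pi_l(i)}\Bigr),$$ $$y_l^{k+1}=\mathrm{prox}_{g_l}^{D_l^{-1}}\Bigl(y_l^k-D_l\bigl(-u_l^k-\Gamma_l(x_{\mathcal{C}_l}^{k+1}-y_l^k)\bigr)\Bigr),$$ $$u_l^{k+1}=u_l^k+\Phi_l\Gamma_l(x_{\mathcal{C}_l}^{k+1}-y_l^{k+1}).$$ *)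

(* Defs.v *)
From HB Require Import structures.
From mathcomp Require Import all_boot all_order all_algebra.
From mathcomp Require Export mxtens.
From mathcomp Require Import all_classical all_reals all_analysis.

Set Implicit Arguments.
Unset Strict Implicit.
Unset Printing Implicit Defensive.

Import Order.TTheory GRing.Theory Num.Theory.
Import numFieldNormedType.Exports.

Local Open Scope classical_set_scope.
Local Open Scope ring_scope.

(* The library norm on matrices is the max norm, so the Euclidean structure
   is spelled out here. *)
Definition dot (R : realType) (m : nat) (u v : 'cV[R]_m) : R :=
  (u^T *m v) 0 0.

Definition enorm (R : realType) (m : nat) (v : 'cV[R]_m) : R :=
  Num.sqrt (dot v v).

Definition wnorm2 (R : realType) (m : nat) (M : 'M[R]_m) (v : 'cV[R]_m) : R :=
  (v^T *m M *m v) 0 0.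

Definition psd (R : realType) (m : nat) (A : 'M[R]_m) : Prop :=
  A^T = A /\ forall v : 'cV[R]_m, 0 <= (v^T *m A *m v) 0 0.

Definition loewner_ge (R : realType) (m : nat) (A B : 'M[R]_m) : Prop :=
  psd (A - B).

Definition proper_fun (R : realType) (m : nat) (h : 'cV[R]_m -> \bar R) : Prop :=
  (forall x, h x != -oo%E) /\ exists x, h x != +oo%E.

Definition closed_fun (R : realType) (m : nat) (h : 'cV[R]_m -> \bar R) : Prop :=
  closed [set p : 'cV[R]_m * R^o | (h p.1 <= (p.2 : R)%:E)%E].

(* Only used together with properness, so that the right-hand side never
   adds +oo and -oo; at t = 0, 1 the library convention 0 * +oo = 0 makes the
   inequality trivial. *)
Definition convex_fun (R : realType) (m : nat) (h : 'cV[R]_m -> \bar R) : Prop :=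
  forall (x y : 'cV[R]_m) (t : R), 0 <= t <= 1 ->
    (h (t *: x + (1 - t) *: y)%R <= t%:E * h x + (1 - t)%R%:E * h y)%E.

Definition ccp (R : realType) (m : nat) (h : 'cV[R]_m -> \bar R) : Prop :=
  [/\ proper_fun h, closed_fun h & convex_fun h].

Definition grad (R : realType) (m : nat) (h : 'cV[R]_m -> R) (x : 'cV[R]_m) :
    'cV[R]_m :=
  \col_j 'D_(delta_mx j 0) (h : 'cV[R]_m -> R^o) x.

Definition convex_smooth (R : realType) (m : nat) (L : R) (h : 'cV[R]_m -> R) :
    Prop :=
  [/\ 0 <= L,
      @convex_function R 'cV[R]_m setT h,
      forall x, differentiable (h : 'cV[R]_m -> R^o) x
    & forall x y, enorm (grad h x - grad h y) <= L * enorm (x - y)].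

Definition ccp_split (R : realType) (m : nat) (L : R)
    (h h1 : 'cV[R]_m -> \bar R) (h2 : 'cV[R]_m -> R) : Prop :=
  [/\ ccp h, ccp h1, convex_smooth L h2
    & forall x, h x = (h1 x + (h2 x)%:E)%E].

(* The set of minimizers; it is the singleton of the usual proximal point when
   h is closed convex proper and M is symmetric positive definite. *)
Definition wprox (R : realType) (m : nat) (M : 'M[R]_m)
    (h : 'cV[R]_m -> \bar R) (x : 'cV[R]_m) : set 'cV[R]_m :=
  [set y | forall z, (h y + (2^-1 * wnorm2 M (x - y))%R%:E
                      <= h z + (2^-1 * wnorm2 M (x - z))%R%:E)%E].

Definition prox (R : realType) (m : nat) (h : 'cV[R]_m -> \bar R)
    (x : 'cV[R]_m) : set 'cV[R]_m :=
  wprox 1%:M h x.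

(* A vector made of m blocks of size d is a column of height m * d; entry r of
   block j sits at position mxtens_index (j, r) = j * d + r, which is also the
   indexing convention of the Kronecker product *t. *)
Definition block (R : realType) (m d : nat) (v : 'cV[R]_(m * d)) (j : 'I_m) :
    'cV[R]_d :=
  \col_r v (mxtens_index (j, r)) 0.

(* enum_val lists the elements of A : {set 'I_n} in increasing order, so
   enum_val : 'I_#|A| -> 'I_n is the inverse of the bijection pi. *)
Definition clique_index (n d : nat) (A : {set 'I_n}) (k : 'I_(#|A| * d)) :
    'I_(n * d) :=
  mxtens_index (enum_val (mxtens_unindex k).1, (mxtens_unindex k).2).

Definition clique_vec (R : realType) (n d : nat) (A : {set 'I_n})
    (x : 'cV[R]_(n * d)) : 'cV[R]_(#|A| * d) :=
  rowsub (@clique_index n d A) x.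

Definition clique_mx (R : realType) (n d : nat) (A : {set 'I_n}) :
    'M[R]_(#|A| * d, n * d) :=
  rowsub (@clique_index n d A) 1%:M.

Lemma clique_mxE (R : realType) (n d : nat) (A : {set 'I_n})
    (x : 'cV[R]_(n * d)) : clique_mx R d A *m x = clique_vec A x.
Proof. by rewrite /clique_mx mul_rowsub_mx mul1mx. Qed.

Definition clique_diag (R : realType) (n d : nat) (A : {set 'I_n})
    (a : 'I_n -> R) : 'M[R]_(#|A| * d) :=
  diag_mx (\row_(j < #|A|) a (enum_val j)) *t (1%:M : 'M[R]_d).

(* [v]_(pi i) for i \in A (and 0 otherwise). *)
Definition agent_block (R : realType) (n d : nat) (A : {set 'I_n})
    (v : 'cV[R]_(#|A| * d)) (i : 'I_n) : 'cV[R]_d :=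
  if [pick j : 'I_#|A| | enum_val j == i] is Some j then block v j else 0.

Lemma agent_block_clique_vec (R : realType) (n d : nat) (A : {set 'I_n})
    (x : 'cV[R]_(n * d)) (i : 'I_n) :
  i \in A -> agent_block (clique_vec A x) i = block x i.
Proof.
move=> iA; rewrite /agent_block; case: pickP => [j /eqP <-|/(_ (enum_rank_in iA i))].
  by apply/colP => r; rewrite !mxE /clique_index mxtens_indexK.
by rewrite enum_rankK_in// eqxx.
Qed.

Definition is_clique (n : nat) (e : rel 'I_n) (A : {set 'I_n}) : Prop :=
  forall i j, i \in A -> j \in A -> i != j -> e i j.

Definition enumerates_cliques (n q : nat) (e : rel 'I_n)
    (C : 'I_q -> {set 'I_n}) : Prop :=
  injective C /\ forall A, is_clique e A <-> exists l, C l = A.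

Definition agent_cliques (n q : nat) (C : 'I_q -> {set 'I_n}) (Q : {set 'I_q})
    (i : 'I_n) : {set 'I_q} :=
  [set l in Q | i \in C l].

(* The variables y and u are families indexed by all of 'I_q; only the
   components in Q are ever used, and stack puts these on top of each other. *)
Definition stack (R : realType) (n q d : nat) (C : 'I_q -> {set 'I_n})
    (Q : {set 'I_q}) (y : forall l : 'I_q, 'cV[R]_(#|C l| * d)) :
    'cV[R]_(\sum_(j < #|Q|) #|C (enum_val j)| * d) :=
  \mxcol_(j < #|Q|) y (enum_val j).

Definition stack_mx (R : realType) (n q d : nat) (C : 'I_q -> {set 'I_n})
    (Q : {set 'I_q}) :
    'M[R]_(\sum_(j < #|Q|) #|C (enum_val j)| * d, n * d) :=
  \mxcol_(j < #|Q|) clique_mx R d (C (enum_val j)).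

Definition Fsum (R : realType) (n d : nat) (f : 'I_n -> 'cV[R]_d -> \bar R)
    (x : 'cV[R]_(n * d)) : \bar R :=
  (\sum_(i < n) f i (block x i))%E.

Definition Gsum (R : realType) (n q d : nat) (C : 'I_q -> {set 'I_n})
    (Q : {set 'I_q}) (g : forall l : 'I_q, 'cV[R]_(#|C l| * d) -> \bar R)
    (y : forall l : 'I_q, 'cV[R]_(#|C l| * d)) : \bar R :=
  (\sum_(l in Q) g l (y l))%E.

Definition lagrangian (R : realType) (n q d : nat) (C : 'I_q -> {set 'I_n})
    (Q : {set 'I_q}) (f : 'I_n -> 'cV[R]_d -> \bar R)
    (g : forall l : 'I_q, 'cV[R]_(#|C l| * d) -> \bar R)
    (x : 'cV[R]_(n * d)) (y u : forall l : 'I_q, 'cV[R]_(#|C l| * d)) : \bar R :=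
  (Fsum f x + Gsum Q g y
   + (dot (stack Q u) (stack_mx R d C Q *m x - stack Q y))%R%:E)%E.

Definition saddle_point (R : realType) (n q d : nat) (C : 'I_q -> {set 'I_n})
    (Q : {set 'I_q}) (f : 'I_n -> 'cV[R]_d -> \bar R)
    (g : forall l : 'I_q, 'cV[R]_(#|C l| * d) -> \bar R)
    (xs : 'cV[R]_(n * d)) (ys us : forall l : 'I_q, 'cV[R]_(#|C l| * d)) : Prop :=
  (forall u, (lagrangian Q f g xs ys u <= lagrangian Q f g xs ys us)%E) /\
  (forall x y, (lagrangian Q f g xs ys us <= lagrangian Q f g x y us)%E).

Definition CL_FLiP_ADMM (R : realType) (n q d : nat) (C : 'I_q -> {set 'I_n})
    (Q : {set 'I_q}) (f1 : 'I_n -> 'cV[R]_d -> \bar R)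
    (f2 : 'I_n -> 'cV[R]_d -> R)
    (g1 : forall l : 'I_q, 'cV[R]_(#|C l| * d) -> \bar R)
    (g2 : forall l : 'I_q, 'cV[R]_(#|C l| * d) -> R)
    (alpha beta gamma phi : 'I_n -> R)
    (x : nat -> 'cV[R]_(n * d))
    (y u : nat -> forall l : 'I_q, 'cV[R]_(#|C l| * d)) : Prop :=
  let Gamma l := clique_diag d (C l) gamma in
  let Phi l := clique_diag d (C l) phi in
  let D l := clique_diag d (C l) beta in
  forall k : nat,
  [/\ forall i : 'I_n,
        prox (fun z => ((alpha i)%:E * f1 i z)%E)
          (block (x k) i - alpha i *:
             (grad (f2 i) (block (x k) i) +
              \sum_(l in agent_cliques C Q i)
                agent_block
                  (u k l + Gamma l *m (clique_vec (C l) (x k) - y k l)) i))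
          (block (x k.+1) i),
      forall l : 'I_q, l \in Q ->
        wprox (invmx (D l)) (g1 l)
          (y k l - D l *m
             (grad (g2 l) (y k l) - u k l -
              Gamma l *m (clique_vec (C l) (x k.+1) - y k l)))
          (y k.+1 l)
    & forall l : 'I_q, l \in Q ->
        u k.+1 l = u k l +
          Phi l *m Gamma l *m (clique_vec (C l) (x k.+1) - y k.+1 l)].

Definition CL_ADMM (R : realType) (n q d : nat) (C : 'I_q -> {set 'I_n})
    (Q : {set 'I_q}) (f : 'I_n -> 'cV[R]_d -> \bar R)
    (g : forall l : 'I_q, 'cV[R]_(#|C l| * d) -> \bar R)
    (alpha beta gamma phi : 'I_n -> R)
    (x : nat -> 'cV[R]_(n * d))
    (y u : nat -> forall l : 'I_q, 'cV[R]_(#|C l| * d)) : Prop :=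
  let Gamma l := clique_diag d (C l) gamma in
  let Phi l := clique_diag d (C l) phi in
  let D l := clique_diag d (C l) beta in
  forall k : nat,
  [/\ forall i : 'I_n,
        prox (fun z => ((alpha i)%:E * f i z)%E)
          (block (x k) i - alpha i *:
             \sum_(l in agent_cliques C Q i)
               agent_block
                 (u k l + Gamma l *m (clique_vec (C l) (x k) - y k l)) i)
          (block (x k.+1) i),
      forall l : 'I_q, l \in Q ->
        wprox (invmx (D l)) (g l)
          (y k l - D l *m
             (- u k l - Gamma l *m (clique_vec (C l) (x k.+1) - y k l)))
          (y k.+1 l)
    & forall l : 'I_q, l \in Q ->
        u k.+1 l = u k l +
          Phi l *m Gamma l *m (clique_vec (C l) (x k.+1) - y k.+1 l)].

(* Main.v *)
(* Write r^k = W x^k - y^k, p_i = 1/alpha_i - gamma_i |Q^i| and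
   V_k = 1/2 (|x^k - x*|^2_p + |y^k - y*|^2_(1/beta) + |u^k - u*|^2_(1/(phi gamma))
              + |y^k - y^(k-1)|^2_(1/beta - gamma + L_g)
              + |r^k|^2_(gamma (2 - phi - eps))).
   Adding the prox-gradient inequalities of the two steps (tested at the saddle
   point) to the monotonicity of the subgradients of g^1 at y^k and y^(k+1)
   gives, for k >= 1,
   F(x^(k+1)) + G(y^(k+1)) - F(x* ) - G(y* ) + <u*, r^(k+1)>
     <= V_k - V_(k+1) - 1/2 |r^(k+1)|^2_(eps gamma),
   whose left-hand side is nonnegative by the saddle point property.  Hence V_k
   decreases to a limit, so r^k and then the objective gap tend to 0. *)
Require Import Defs.
From HB Require Import structures.
From mathcomp Require Import all_boot all_order all_algebra.
From mathcomp Require Import all_classical all_reals all_analysis.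
From mathcomp Require Import ring lra.

Set Implicit Arguments.
Unset Strict Implicit.
Unset Printing Implicit Defensive.

Import Order.TTheory GRing.Theory Num.Theory.
Import numFieldNormedType.Exports.

Local Open Scope classical_set_scope.
Local Open Scope ring_scope.

(** * Euclidean inner product and norm *)

Lemma dotE (R : realType) m (u v : 'cV[R]_m) :
  dot u v = \sum_k u k 0 * v k 0.
Proof. by rewrite /dot mxE; apply: eq_bigr => k _; rewrite mxE. Qed.

Lemma dotC (R : realType) m (u v : 'cV[R]_m) : dot u v = dot v u.
Proof. by rewrite !dotE; apply: eq_bigr => k _; rewrite mulrC. Qed.

Lemma dotDr (R : realType) m (u v w : 'cV[R]_m) :
  dot u (v + w) = dot u v + dot u w.
Proof. by rewrite /dot mulmxDr mxE. Qed.

Lemma dotNr (R : realType) m (u v : 'cV[R]_m) : dot u (- v) = - dot u v.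
Proof. by rewrite /dot mulmxN mxE. Qed.

Lemma dotZr (R : realType) m (u v : 'cV[R]_m) a : dot u (a *: v) = a * dot u v.
Proof. by rewrite /dot -scalemxAr mxE. Qed.

Lemma dotDl (R : realType) m (u v w : 'cV[R]_m) :
  dot (u + v) w = dot u w + dot v w.
Proof. by rewrite dotC dotDr !(dotC w). Qed.

Lemma dotNl (R : realType) m (u v : 'cV[R]_m) : dot (- u) v = - dot u v.
Proof. by rewrite dotC dotNr dotC. Qed.

Lemma dotZl (R : realType) m (u v : 'cV[R]_m) a : dot (a *: u) v = a * dot u v.
Proof. by rewrite dotC dotZr dotC. Qed.

Lemma dot_suml (R : realType) m (I : finType) (P : pred I)
    (u : I -> 'cV[R]_m) v :
  dot (\sum_(i | P i) u i) v = \sum_(i | P i) dot (u i) v.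
Proof. by rewrite /dot raddf_sum mulmx_suml summxE. Qed.

Lemma dot_ge0 (R : realType) m (u : 'cV[R]_m) : 0 <= dot u u.
Proof. by rewrite dotE; apply: sumr_ge0 => k _; rewrite -expr2 sqr_ge0. Qed.

Lemma enorm_ge0 (R : realType) m (u : 'cV[R]_m) : 0 <= enorm u.
Proof. exact: sqrtr_ge0. Qed.

Lemma sqr_enorm (R : realType) m (u : 'cV[R]_m) : enorm u ^+ 2 = dot u u.
Proof. by rewrite sqr_sqrtr// dot_ge0. Qed.

Lemma enormZ (R : realType) m (u : 'cV[R]_m) a : enorm (a *: u) = `|a| * enorm u.
Proof. by rewrite /enorm dotZl dotZr mulrA -expr2 sqrtrM ?sqr_ge0// sqrtr_sqr. Qed.

Lemma dot_eq0 (R : realType) m (u : 'cV[R]_m) : dot u u = 0 -> u = 0.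
Proof.
rewrite dotE => /eqP; rewrite psumr_eq0 => [/allP u0|k _]; last first.
  by rewrite -expr2 sqr_ge0.
apply/colP => k; apply/eqP; have := u0 k (mem_index_enum k).
by rewrite mxE /= mulf_eq0 orbb.
Qed.

Lemma cauchy_schwarz (R : realType) m (u v : 'cV[R]_m) :
  dot u v <= enorm u * enorm v.
Proof.
have [uv0|uv0] := eqVneq (enorm u * enorm v) 0.
  have nul (w : 'cV[R]_m) : enorm w == 0 -> w = 0.
    by move/eqP => w0; apply: dot_eq0; rewrite -sqr_enorm w0 expr0n.
  rewrite uv0; move/eqP: uv0; rewrite mulf_eq0 => /orP[] /nul->.
    by rewrite dotE big1// => k _; rewrite mxE mul0r.
  by rewrite dotE big1// => k _; rewrite mxE mulr0.
have uv : 0 < enorm u * enorm v by rewrite lt_def uv0 mulr_ge0 ?enorm_ge0.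
have := dot_ge0 (enorm v *: u - enorm u *: v).
rewrite !(dotDl, dotDr, dotNl, dotNr, dotZl, dotZr) (dotC v u) -!sqr_enorm => h.
rewrite -subr_ge0 -(pmulr_rge0 _ uv); nra.
Qed.

Lemma enormN (R : realType) m (u : 'cV[R]_m) : enorm (- u) = enorm u.
Proof. by rewrite -scaleN1r enormZ normrN1 mul1r. Qed.

Lemma normr_dot_le (R : realType) m (u v : 'cV[R]_m) :
  `|dot u v| <= enorm u * enorm v.
Proof.
by rewrite ler_norml cauchy_schwarz andbT lerNl -dotNl -(enormN u) cauchy_schwarz.
Qed.

(** Carries convergence from the Euclidean norm over to the max norm, which is the library norm on
    matrices. *)
Lemma normr_le_enorm (R : realType) m (v : 'cV[R]_m) : `|v| <= enorm v.
Proof.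
rewrite /Num.norm /= mx_normrE; apply: bigmax_le => [|[i j] _].
  exact: enorm_ge0.
rewrite ord1 -[leLHS]sqrtr_sqr ler_sqrt ?dot_ge0//= dotE (bigD1 i)//= expr2.
by rewrite lerDl sumr_ge0// => k _; rewrite -expr2 sqr_ge0.
Qed.

(** Replaces the limit [t -> 0] in the first-order convexity and optimality arguments. *)
Lemma le0_small_mul (R : realType) (a b : R) :
  (forall t, 0 < t <= 1 -> a <= t * b) -> a <= 0.
Proof.
move=> h; rewrite leNgt; apply/negP => a0.
(* With this [c], the choice [t = a / (2 * c)] is at most 1/2 and makes [t * b] at most [a / 2]. *)
pose c := a + `|b|.
have c0 : 0 < c by rewrite ltr_wpDr.
have t1 : 0 < a / (2 * c) <= 1.
  rewrite divr_gt0 ?mulr_gt0//= ler_pdivrMr ?mulr_gt0// mul1r.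
  have := normr_ge0 b; rewrite /c; lra.
have {h} := h _ t1; apply/negP; rewrite -ltNge mulrAC ltr_pdivrMr ?mulr_gt0//.
by rewrite ltr_pM2l// /c; have := ler_norm b; have := normr_ge0 b; lra.
Qed.

(** * Gradients and smooth convex functions *)

Lemma grad_dot (R : realType) m (h : 'cV[R]_m -> R) (x v : 'cV[R]_m) :
  differentiable (h : 'cV[R]_m -> R^o) x ->
  'D_v (h : 'cV[R]_m -> R^o) x = dot (grad h x) v.
Proof.
move=> hx; rewrite deriveE// dotE.
have {1}-> : v = \sum_k v k 0 *: delta_mx k 0.
  rewrite [LHS]matrix_sum_delta; apply: eq_bigr => k _.
  by rewrite big_ord1.
rewrite linear_sum; apply: eq_bigr => k _.
by rewrite linearZ /= mxE deriveE// mulrC.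
Qed.

Lemma is_derive_line (R : realType) m (h : 'cV[R]_m -> R) (x v : 'cV[R]_m)
    (t : R) :
  differentiable (h : 'cV[R]_m -> R^o) (x + t *: v) ->
  is_derive t (1 : R) (fun s : R => h (x + s *: v) : R)
    (dot (grad h (x + t *: v)) v).
Proof.
move=> hx; rewrite -grad_dot//.
have E : (fun a : R => a^-1 *: (((fun s : R => h (x + s *: v) : R^o) \o shift t)
             (a *: 1) - h (x + t *: v)))
       = (fun a : R => a^-1 *: (((h : 'cV[R]_m -> R^o) \o shift (x + t *: v))
             (a *: v) - h (x + t *: v))).
  apply/funext => a /=; congr (_ *: (h _ - _)).
  by rewrite scalerDl /GRing.scale /= mulr1 addrCA.
split; last by rewrite /derive E.
by rewrite /derivable E; exact: diff_derivable.
Qed.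

(* The sign [s] gives the bounds from above and from below at once. *)
Lemma descent_lemma (R : realType) m (L : R) (h : 'cV[R]_m -> R)
    (x v : 'cV[R]_m) (s : R) :
  convex_smooth L h -> s ^+ 2 = 1 ->
  s * (h (x + v) - h x - dot (grad h x) v) <= L / 2 * dot v v.
Proof.
move=> [L0 _ dh lip] s1.
(* Up to a constant, [psi] is the signed first-order remainder minus its claimed bound along the
   segment. Lipschitz continuity and Cauchy-Schwarz make [dpsi] nonpositive on [[0, 1]], so the mean
   value theorem gives [psi 1 <= psi 0]. *)
pose psi (t : R) : R := s * (h (x + t *: v)) - (s * dot (grad h x) v) * t
  - (L / 2 * dot v v) * t ^+ 2.
pose dpsi (t : R) : R := s * dot (grad h (x + t *: v)) v - s * dot (grad h x) v
  - L * dot v v * t.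
have dpsiP t : is_derive t (1 : R) psi (dpsi t).
  have H := is_derive_line (dh (x + t *: v)).
  apply: is_derive_eq; rewrite /dpsi /GRing.scale /=.
  rewrite ?(mulr0, mul0r, addr0, add0r, scaler0, mulr1).
  by field.
have psic : {within `[0, 1], continuous psi}.
  apply: derivable_within_continuous => t _.
  by have [] := dpsiP t.
have [c /itvP c01] := MVT ltr01 (fun t _ => dpsiP t) psic.
have -> : psi 1 - psi 0 =
    s * (h (x + v) - h x - dot (grad h x) v) - L / 2 * dot v v.
  by rewrite /psi scale1r scale0r addr0; ring.
move=> psiE; rewrite -subr_le0 psiE subr0 mulr1 /dpsi subr_le0 -mulrBr.
rewrite -dotNl -dotDl -[s * _]dotZl (le_trans (cauchy_schwarz _ _))// enormZ.
have -> : `|s| = 1.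
  by apply/eqP; rewrite -(eqrXn2 (n := 2))// real_normK ?num_real// s1 expr1n.
rewrite mul1r (le_trans (ler_wpM2r (enorm_ge0 v) (lip _ _)))//.
rewrite addrAC subrr add0r enormZ ger0_norm ?c01// -sqr_enorm; lra.
Qed.

Lemma smooth_upper_bound (R : realType) m (L : R) (h : 'cV[R]_m -> R)
    (x v : 'cV[R]_m) :
  convex_smooth L h -> h (x + v) <= h x + dot (grad h x) v + L / 2 * dot v v.
Proof.
by move=> /descent_lemma -/(_ x v 1); rewrite expr1n mul1r => /(_ erefl); lra.
Qed.

(** The lower descent bound at x + t v is compared with convexity on the segment; after division by
    t the error is t L/2 |v|^2, which vanishes with t. *)
Lemma convex_gradient_ineq (R : realType) m (L : R) (h : 'cV[R]_m -> R)
    (x v : 'cV[R]_m) :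
  convex_smooth L h -> h x + dot (grad h x) v <= h (x + v).
Proof.
move=> hL; have [_ cvx _ _] := hL.
rewrite -subr_le0; apply: (@le0_small_mul _ _ (L / 2 * dot v v)).
move=> t /andP[t0 t1].
have := @descent_lemma _ _ _ _ x (t *: v) (-1) hL.
rewrite sqrrN expr1n !(dotZr, dotZl) => /(_ erefl) low.
have t01 : 0 <= t <= 1 by rewrite ltW.
pose p : {i01 R} := Itv01 (ltW t0) t1.
have := cvx p (x + v) x; rewrite !inE => /(_ I I).
rewrite convRE /conv /= /unstable.onem.
have -> : t *: (x + v) + (1 - t) *: x = x + t *: v.
  by apply/colP => k; rewrite !mxE; ring.
move=> cv; rewrite -(ler_pM2l t0); lra.
Qed.

(** * Subgradients and proximal steps *)

Definition subgradient (R : realType) m (h : 'cV[R]_m -> \bar R)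
    (s y : 'cV[R]_m) : Prop :=
  h y \is a fin_num /\ forall z, (h y + (dot s (z - y))%:E <= h z)%E.

Lemma wnorm2B (R : realType) m (M : 'M[R]_m) (p v : 'cV[R]_m) (t : R) :
  M^T = M ->
  wnorm2 M (p - t *: v) =
  wnorm2 M p - 2 * t * dot (M *m p) v + t ^+ 2 * wnorm2 M v.
Proof.
move=> Ms; have wE w : wnorm2 M w = dot w (M *m w).
  by rewrite /wnorm2 /dot mulmxA.
have Mdot a b : dot a (M *m b) = dot (M *m a) b.
  by rewrite /dot trmx_mul Ms mulmxA.
rewrite !wE mulmxBr -scalemxAr !(dotDl, dotDr, dotNl, dotNr, dotZl, dotZr).
rewrite (Mdot p v) (dotC v (M *m p)); ring.
Qed.

(** First-order optimality: the minimizer y is compared with y + t (z - y), where convexity bounds h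
    and the quadratic term is linear in t up to order t^2. *)
Lemma wprox_subgradient (R : realType) m (M : 'M[R]_m) (h : 'cV[R]_m -> \bar R)
    (x y : 'cV[R]_m) :
  M^T = M -> proper_fun h -> convex_fun h -> wprox M h x y ->
  subgradient h (M *m (x - y)) y.
Proof.
move=> Ms [hNy [z0 hz0]] cvx hp.
have hyfin : h y \is a fin_num.
  have := hp z0; move: (hNy y) (hNy z0) hz0.
  by case: (h y) => [a||] //; case: (h z0) => [b||].
split=> // z; have [->|hzy] := eqVneq (h z) +oo%E; first by rewrite leey.
have : h z \is a fin_num by move: hzy (hNy z); case: (h z).
move: (hyfin) => /fineK hyE /fineK hzE; rewrite -hzE -hyE -EFinD lee_fin -subr_le0.
apply: (@le0_small_mul _ _ (2^-1 * wnorm2 M (z - y))) => t /andP[t0 t1].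
have t01 : 0 <= t <= 1 by rewrite ltW.
have := hp (t *: z + (1 - t) *: y); have := cvx z y t t01.
rewrite -hzE -hyE; case: (h (t *: z + _)) (hNy (t *: z + (1 - t) *: y)) => //.
move=> c _; rewrite -!EFinM -!EFinD !lee_fin.
have -> : x - (t *: z + (1 - t) *: y) = (x - y) - t *: (z - y).
  by apply/colP => k; rewrite !mxE; ring.
rewrite wnorm2B// => hc hw.
rewrite -(ler_pM2l t0); lra.
Qed.

(** Dividing the minimized sum by [a] moves the step size into the metric, so that the x-step and
    the y-step share one optimality condition. *)
Lemma prox_scale (R : realType) m (h : 'cV[R]_m -> \bar R) (x y : 'cV[R]_m)
    (a : R) :
  0 < a -> proper_fun h -> prox (fun z => (a%:E * h z)%E) x y ->
  wprox (a^-1)%:M h x y.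
Proof.
move=> a0 [hNy _] hp z.
have wE v : wnorm2 (a^-1)%:M v = a^-1 * wnorm2 1%:M v.
  by rewrite /wnorm2 !mul_mx_scalar -scalemxAl mxE scale1r.
have := hp z; rewrite !wE; move: (hNy y) (hNy z).
case: (h z) => [c||] //; last by rewrite leey.
case: (h y) => [b||] //; last by rewrite gt0_muley ?lte_fin.
move=> _ _; rewrite -!EFinM -!EFinD !lee_fin => hbc.
have E v w : a * (v + 2^-1 * (a^-1 * w)) = a * v + 2^-1 * w.
  by field; rewrite gt_eqF.
by rewrite -(ler_pM2l a0) !E.
Qed.

(* Convexity at [x], descent from [x] to [y], and the subgradient at [y]. *)
Lemma forward_backward_ineq (R : realType) m (L : R) (h h1 : 'cV[R]_m -> \bar R)
    (h2 : 'cV[R]_m -> R) (x y z s : 'cV[R]_m) :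
  ccp_split L h h1 h2 -> subgradient h1 (s - grad h2 x) y ->
  h z \is a fin_num ->
  h y \is a fin_num /\
  fine (h y) - fine (h z) <= dot s (y - z) + L / 2 * dot (y - x) (y - x).
Proof.
move=> [_ _ hL hE] [h1y sub] hz.
have h1z : h1 z \is a fin_num.
  by move: hz; rewrite hE; case: (h1 z).
split; first by rewrite hE fin_numD h1y.
have := sub z; rewrite !hE -(fineK h1y) -(fineK h1z) -!EFinD lee_fin /= => {}sub.
have := smooth_upper_bound x (y - x) hL; have := convex_gradient_ineq x (z - x) hL.
have E w : x + (w - x) = w by rewrite addrC subrK.
move: sub; rewrite !E !(dotDr, dotDl, dotNl, dotNr); lra.
Qed.

Lemma subgradient_monotone (R : realType) m (h : 'cV[R]_m -> \bar R)
    (s s' y y' : 'cV[R]_m) :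
  subgradient h s y -> subgradient h s' y' -> 0 <= dot (s' - s) (y' - y).
Proof.
move=> [hy sub] [hy' sub']; have := sub y'; have := sub' y.
rewrite -(fineK hy) -(fineK hy') -!EFinD !lee_fin !(dotDr, dotDl, dotNl, dotNr).
lra.
Qed.

(** * Coordinates and blocks of clique vectors *)

(** Parameter matrices act on coordinate [k] as multiplication by the parameter of this agent, which
    reduces the y and u estimates to scalar ones. *)
Definition entry_agent (n d : nat) (A : {set 'I_n}) (k : 'I_(#|A| * d)) : 'I_n :=
  enum_val (mxtens_unindex k).1.

Lemma entry_agent_in (n d : nat) (A : {set 'I_n}) (k : 'I_(#|A| * d)) :
  entry_agent k \in A.
Proof. exact: enum_valP. Qed.

Lemma clique_diagE (R : realType) (n d : nat) (A : {set 'I_n}) (a : 'I_n -> R) :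
  clique_diag d A a = diag_mx (\row_k a (entry_agent k)).
Proof.
apply/matrixP => i j; rewrite /clique_diag !mxE /entry_agent.
case: (mxtens_indexP i) => i1 i2; case: (mxtens_indexP j) => j1 j2.
rewrite !mxtens_indexK /= (can_eq (@mxtens_indexK _ _)) xpair_eqE.
by case: eqP => [->|]; case: eqP; rewrite ?mulr1 ?mulr0 ?mul0r ?mulr0n.
Qed.

Lemma mul_clique_diag (R : realType) (n d : nat) (A : {set 'I_n})
    (a : 'I_n -> R) (v : 'cV[R]_(#|A| * d)) k :
  (clique_diag d A a *m v) k 0 = a (entry_agent k) * v k 0.
Proof. by rewrite clique_diagE mul_diag_mx !mxE. Qed.

Lemma invmx_clique_diag (R : realType) (n d : nat) (A : {set 'I_n})
    (a : 'I_n -> R) : (forall i, a i != 0) ->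
  invmx (clique_diag d A a) = clique_diag d A (fun i => (a i)^-1).
Proof.
move=> a0.
have aV : clique_diag d A a *m clique_diag d A (fun i => (a i)^-1) = 1%:M.
  rewrite !clique_diagE mulmx_diag; apply/matrixP => i j.
  by rewrite !mxE divff// mulr1n.
have [aU _] := mulmx1_unit aV.
by rewrite -[LHS]mulmx1 -aV mulmxA mulVmx// mul1mx.
Qed.

Lemma tr_clique_diag (R : realType) (n d : nat) (A : {set 'I_n})
    (a : 'I_n -> R) : (clique_diag d A a)^T = clique_diag d A a.
Proof. by rewrite !clique_diagE tr_diag_mx. Qed.

Lemma sum_agent_block (R : realType) (n d : nat) (A : {set 'I_n})
    (v : 'cV[R]_(#|A| * d)) (z : 'cV[R]_(n * d)) :
  \sum_(i in A) dot (agent_block v i) (block z i) = dot v (clique_vec A z).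
Proof.
rewrite big_enum_val /= dotE.
rewrite (reindex (@mxtens_index #|A| d)) /=; last first.
  by exists (@mxtens_unindex _ _) => ? _; rewrite ?mxtens_indexK ?mxtens_unindexK.
transitivity (\sum_j \sum_r v (mxtens_index (j, r)) 0 *
    clique_vec A z (mxtens_index (j, r)) 0); last first.
  by rewrite pair_bigA; apply: eq_bigr => -[].
apply: eq_bigr => j _; rewrite /agent_block.
case: pickP => [j' /eqP/enum_val_inj->|/(_ j)]; last by rewrite eqxx.
rewrite dotE; apply: eq_bigr => r _.
by rewrite !mxE /clique_index mxtens_indexK.
Qed.

(** The agent-wise sums in the x-step are the transpose of the stacked clique restriction: the sum
    over pairs of a clique and one of its members is exchanged. *)
Lemma sum_agent_cliques (R : realType) (n d q : nat) (C : 'I_q -> {set 'I_n})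
    (Q : {set 'I_q}) (v : forall l, 'cV[R]_(#|C l| * d)) (z : 'cV[R]_(n * d)) :
  \sum_i dot (\sum_(l in agent_cliques C Q i) agent_block (v l) i) (block z i) =
  \sum_(l in Q) dot (v l) (clique_vec (C l) z).
Proof.
under eq_bigr => i _ do rewrite dot_suml.
rewrite (exchange_big_dep [in Q])/=; last by move=> i l _; rewrite inE => /andP[].
apply: eq_bigr => l lQ; rewrite -sum_agent_block.
by apply: eq_bigl => i; rewrite inE lQ.
Qed.

Lemma dot_stack (R : realType) (n d q : nat) (C : 'I_q -> {set 'I_n})
    (Q : {set 'I_q}) (v w : forall l, 'cV[R]_(#|C l| * d)) :
  dot (stack Q v) (stack Q w) = \sum_(l in Q) dot (v l) (w l).
Proof.
by rewrite /dot /stack tr_mxcol mul_mxrow_mxcol summxE [RHS]big_enum_val.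
Qed.

Lemma stack_residual (R : realType) (n d q : nat) (C : 'I_q -> {set 'I_n})
    (Q : {set 'I_q}) (x : 'cV[R]_(n * d)) (y : forall l, 'cV[R]_(#|C l| * d)) :
  stack_mx R d C Q *m x - stack Q y =
  stack Q (fun l => clique_vec (C l) x - y l).
Proof.
rewrite /stack_mx /stack mxcol_mul -mxcolB.
by apply: eq_mxcol => j; rewrite clique_mxE.
Qed.

Lemma agent_block_clique_diag (R : realType) (n d : nat) (A : {set 'I_n})
    (a : 'I_n -> R) (w : 'cV[R]_(n * d)) i :
  i \in A -> agent_block (clique_diag d A a *m clique_vec A w) i = a i *: block w i.
Proof.
move=> iA; rewrite -(agent_block_clique_vec _ iA) /agent_block.
case: pickP => [j /eqP ji|_]; last by rewrite scaler0.
apply/colP => r; rewrite mxE mul_clique_diag [RHS]mxE [in RHS]mxE.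
by rewrite /entry_agent mxtens_indexK ji.
Qed.

Lemma blockB (R : realType) (n d : nat) (v w : 'cV[R]_(n * d)) i :
  block (v - w) i = block v i - block w i.
Proof. by apply/colP => r; rewrite !mxE. Qed.

Lemma clique_vecB (R : realType) (n d : nat) (A : {set 'I_n})
    (v w : 'cV[R]_(n * d)) :
  clique_vec A (v - w) = clique_vec A v - clique_vec A w.
Proof. by apply/colP => r; rewrite !mxE. Qed.

(** * Objective, Lagrangian and saddle points *)

(** Meaningful on [in_domain] only, since [fine] sends both infinities to 0. *)
Definition objective (R : realType) (n q d : nat) (C : 'I_q -> {set 'I_n})
    (Q : {set 'I_q}) (f : 'I_n -> 'cV[R]_d -> \bar R)
    (g : forall l : 'I_q, 'cV[R]_(#|C l| * d) -> \bar R)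
    (x : 'cV[R]_(n * d)) (y : forall l : 'I_q, 'cV[R]_(#|C l| * d)) : R :=
  \sum_i fine (f i (block x i)) + \sum_(l in Q) fine (g l (y l)).

Definition in_domain (R : realType) (n q d : nat) (C : 'I_q -> {set 'I_n})
    (Q : {set 'I_q}) (f : 'I_n -> 'cV[R]_d -> \bar R)
    (g : forall l : 'I_q, 'cV[R]_(#|C l| * d) -> \bar R)
    (x : 'cV[R]_(n * d)) (y : forall l : 'I_q, 'cV[R]_(#|C l| * d)) : Prop :=
  (forall i, f i (block x i) \is a fin_num) /\
  (forall l, l \in Q -> g l (y l) \is a fin_num).

Lemma FGsum_fin (R : realType) (n q d : nat) (C : 'I_q -> {set 'I_n})
    (Q : {set 'I_q}) (f : 'I_n -> 'cV[R]_d -> \bar R)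
    (g : forall l : 'I_q, 'cV[R]_(#|C l| * d) -> \bar R) x y :
  in_domain Q f g x y ->
  (Fsum f x + Gsum Q g y)%E = (objective Q f g x y)%:E.
Proof.
move=> [fx gy]; rewrite /objective EFinD -!sumEFin /Fsum /Gsum.
by congr (_ + _)%E; apply: eq_bigr => i hi; rewrite fineK ?fx ?gy.
Qed.

Lemma lagrangianE (R : realType) (n q d : nat) (C : 'I_q -> {set 'I_n})
    (Q : {set 'I_q}) (f : 'I_n -> 'cV[R]_d -> \bar R)
    (g : forall l : 'I_q, 'cV[R]_(#|C l| * d) -> \bar R) x y u :
  lagrangian Q f g x y u = (Fsum f x + Gsum Q g y +
    (\sum_(l in Q) dot (u l) (clique_vec (C l) x - y l))%:E)%E.
Proof. by rewrite /lagrangian stack_residual dot_stack. Qed.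

Lemma block_col (R : realType) (n d : nat) (X : 'I_n -> 'cV[R]_d) i :
  block (\col_k X (mxtens_unindex k).1 (mxtens_unindex k).2 0) i = X i.
Proof. by apply/colP => r; rewrite !mxE mxtens_indexK. Qed.

(** Minimality against a point of finite objective gives finiteness, maximality in the multiplier
    gives feasibility, and feasibility removes the coupling term at the saddle point. *)
Lemma saddle_pointP (R : realType) (n q d : nat) (C : 'I_q -> {set 'I_n})
    (Q : {set 'I_q}) (f : 'I_n -> 'cV[R]_d -> \bar R)
    (g : forall l : 'I_q, 'cV[R]_(#|C l| * d) -> \bar R) xs ys us :
  (forall i, proper_fun (f i)) -> (forall l, l \in Q -> proper_fun (g l)) ->
  saddle_point Q f g xs ys us ->
  [/\ in_domain Q f g xs ys,
      forall l, l \in Q -> clique_vec (C l) xs = ys l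
    & forall x y, in_domain Q f g x y ->
        objective Q f g xs ys <= objective Q f g x y +
          \sum_(l in Q) dot (us l) (clique_vec (C l) x - y l)].
Proof.
move=> pf pg [smax smin].
have dom : in_domain Q f g xs ys.
  have hX i : exists x, f i x != +oo%E by have [_] := pf i.
  have hY l : exists y, l \in Q -> g l y != +oo%E.
    have [/pg[_ [y hy]]|] := boolP (l \in Q); first by exists y.
    by exists 0.
  pose X i := sval (cid (hX i)); pose Y l := sval (cid (hY l)).
  pose x : 'cV[R]_(n * d) := \col_k X (mxtens_unindex k).1 (mxtens_unindex k).2 0.
  have dXY : in_domain Q f g x Y.
    split=> [i|l lQ]; rewrite fin_numE.
      by rewrite block_col (svalP (cid (hX i))) (pf i).1.
    by rewrite (svalP (cid (hY l))) ?(pg l lQ).1.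
  have := smin x Y; rewrite !lagrangianE (FGsum_fin dXY) => fin.
  (* The finite upper bound excludes +oo for the sum; as properness excludes -oo, each summand is
     finite. *)
  have : (Fsum f xs + Gsum Q g ys != +oo)%E by apply: contraTneq fin => ->.
  rewrite adde_Neq_pinfty; last 2 first.
  - by rewrite /Fsum esum_eqNy negb_exists; apply/forallP => i; rewrite (pf i).1.
  - rewrite /Gsum esum_eqNy negb_exists; apply/forallP => l.
    by have [lQ|//] := boolP (l \in Q); rewrite (pg l lQ).1.
  rewrite /Fsum /Gsum esum_eqy => [|i _]; last exact: (pf i).1.
  rewrite esum_eqy => [|l lQ]; last exact: (pg l lQ).1.
  rewrite !negb_exists => /andP[/forallP hf /forallP hg].
  split=> [i|l lQ]; rewrite fin_numE.
    by rewrite (pf i).1; have := hf i.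
  by rewrite (pg l lQ).1; have := hg l; rewrite lQ.
have feas l : l \in Q -> clique_vec (C l) xs = ys l.
  (* Shifting [us] by the residual raises the Lagrangian by the squared residual, which must
     therefore vanish. *)
  have := smax (fun l => us l + (clique_vec (C l) xs - ys l)).
  rewrite !lagrangianE (FGsum_fin dom) -!EFinD lee_fin lerD2l.
  under eq_bigr do rewrite dotDl.
  rewrite big_split /= gerDl => le0 lQ; apply/eqP; rewrite -subr_eq0; apply/eqP.
  have : \sum_(l in Q)
      dot (clique_vec (C l) xs - ys l) (clique_vec (C l) xs - ys l) == 0.
    by rewrite eq_le le0 sumr_ge0// => ? _; exact: dot_ge0.
  rewrite psumr_eq0 => [/allP/(_ l)|? _]; last exact: dot_ge0.
  by rewrite mem_index_enum lQ => /(_ isT)/eqP/dot_eq0.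
split=> // x y dxy; have := smin x y.
rewrite !lagrangianE (FGsum_fin dom) (FGsum_fin dxy) -!EFinD lee_fin.
rewrite [X in _ + X <= _]big1 ?addr0// => l lQ.
by rewrite feas// subrr dotE big1// => k _; rewrite mxE mulr0.
Qed.

(** * The scalar inequality behind the descent *)

(** One coordinate of a clique: [y0], [y1], [y2] are consecutive values of y and [a] is the newest
    x. The factor in front of [(y2 - y1)] on the fourth line of the left-hand side is the increment
    of [dual_direction]; this product and the next [L / 2] term are known to be nonnegative only
    after summation over coordinates, so they are carried along. *)
Lemma entry_descent (R : realType) (gam ph b ep L a y0 y1 y2 r1 u1 u2 ys us : R) :
  0 < gam -> 0 < ph -> 0 < ep < 2 - ph -> 0 <= b - gam ->
  3 * L <= gam * (1 - (1 - ph) ^+ 2 / (2 - ph - ep)) + (b - gam) ->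
  u2 = u1 + ph * gam * (a - y2) ->
  let pot y0 y1 u1 r1 := 2^-1 * (b * (y1 - ys) ^+ 2 + (u1 - us) ^+ 2 / (ph * gam)
    + (b - gam + L) * (y1 - y0) ^+ 2 + gam * (2 - ph - ep) * r1 ^+ 2) in
  us * (a - y2) - (u1 + gam * (a - y1)) * (a - ys)
  + (b * (y1 - y2) + (u1 + gam * (a - y1))) * (y2 - ys)
  + L / 2 * (y2 - y1) ^+ 2
  + ((b - gam) * ((y1 - y0) - (y2 - y1)) + gam * (a - y2) - (1 - ph) * gam * r1)
    * (y2 - y1)
  + L / 2 * ((y1 - y0) ^+ 2 + (y2 - y1) ^+ 2)
  + 2^-1 * (ep * gam * (a - y2) ^+ 2)
  <= pot y0 y1 u1 r1 - pot y1 y2 u2 (a - y2).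
Proof.
move=> g0 p0 /andP[e0 e1] bg hL ->/=.
have eta0 : 0 < 2 - ph - ep by lra.
rewrite -subr_ge0.
set rhs := (X in 0 <= X).
(* The mixed term in [r1] and [y2 - y1] is completed to a square, and the bound on [3 * L] controls
   the remaining multiple of [(y2 - y1) ^+ 2]. The three halves of [L] come from the smooth descent,
   the monotonicity estimate and the next potential. *)
have -> : rhs = 2^-1 * ((b - gam) * ((y2 - y1) - (y1 - y0)) ^+ 2
   + gam * (2 - ph - ep) * (r1 + (1 - ph) / (2 - ph - ep) * (y2 - y1)) ^+ 2
   + (gam * (1 - (1 - ph) ^+ 2 / (2 - ph - ep)) + (b - gam) - 3 * L)
     * (y2 - y1) ^+ 2).
  by rewrite /rhs; field; rewrite !gt_eqF.
rewrite mulr_ge0 ?invr_ge0// !addr_ge0// mulr_ge0 ?sqr_ge0//.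
  by rewrite mulr_ge0// ltW.
by rewrite subr_ge0.
Qed.

(** * Optimality conditions of the iteration and the potential *)

Section FLiP_descent.

Context (R : realType) (n d q : nat) (C : 'I_q -> {set 'I_n}) (Q : {set 'I_q}).
Context (f f1 : 'I_n -> 'cV[R]_d -> \bar R) (f2 : 'I_n -> 'cV[R]_d -> R).
Context (g g1 : forall l : 'I_q, 'cV[R]_(#|C l| * d) -> \bar R).
Context (g2 : forall l : 'I_q, 'cV[R]_(#|C l| * d) -> R).
Arguments g : clear implicits.
Arguments g1 : clear implicits.
Arguments g2 : clear implicits.
Context (Lf : 'I_n -> R) (Lg : 'I_q -> R) (alpha beta gamma phi eps : 'I_n -> R).
Context (halpha : forall i, 0 < alpha i) (hbeta : forall i, 0 < beta i).
Context (hgamma : forall i, 0 < gamma i) (hphi : forall i, 0 < phi i).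
Context (hf : forall i, ccp_split (Lf i) (f i) (f1 i) (f2 i)).
Context (hg : forall l, l \in Q -> ccp_split (Lg l) (g l) (g1 l) (g2 l)).
Context (x : nat -> 'cV[R]_(n * d)).
Context (y u : nat -> forall l : 'I_q, 'cV[R]_(#|C l| * d)).
Context (hiter : CL_FLiP_ADMM Q f1 f2 g1 g2 alpha beta gamma phi x y u).
Context (xs : 'cV[R]_(n * d)) (ys us : forall l : 'I_q, 'cV[R]_(#|C l| * d)).
Context (heps : forall i, 0 < eps i < 2 - phi i).
Context (hx : forall i,
  gamma i * #|agent_cliques C Q i|%:R + Lf i <= (alpha i)^-1).
Context (hy : forall i, 0 <= (beta i)^-1 - gamma i).
(* [0 < d] because the Loewner inequality says nothing for 0 x 0 matrices. *)
Context (hyg : forall i l, (0 < d)%N -> l \in Q -> i \in C l ->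
  3 * Lg l <= gamma i * (1 - (1 - phi i) ^+ 2 / (2 - phi i - eps i))
              + ((beta i)^-1 - gamma i)).

Definition residual k l : 'cV[R]_(#|C l| * d) := clique_vec (C l) (x k) - y k l.

Definition multiplier_estimate k l : 'cV[R]_(#|C l| * d) :=
  u k l + clique_diag d (C l) gamma *m (clique_vec (C l) (x k.+1) - y k l).

(** By [y_step], this is a subgradient of [g1 l] at y^(k+1) plus the gradient of [g2 l] at y^k. *)
Definition dual_direction k l : 'cV[R]_(#|C l| * d) :=
  clique_diag d (C l) (fun i => (beta i)^-1) *m (y k l - y k.+1 l)
  + multiplier_estimate k l.

Lemma x_step k i :
  subgradient (f1 i)
    ((alpha i)^-1 *: block (x k - x k.+1) i
     - \sum_(l in agent_cliques C Q i) agent_block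
         (u k l + clique_diag d (C l) gamma *m (clique_vec (C l) (x k) - y k l)) i
     - grad (f2 i) (block (x k) i))
    (block (x k.+1) i).
Proof.
have [hprox _ _] := hiter k; have [_ [pf _ cf] _ _] := hf i.
set S := \sum_(l in _) _.
have /wprox_subgradient := prox_scale (halpha i) pf (hprox i).
rewrite tr_scalar_mx => /(_ erefl pf cf); congr subgradient.
rewrite mul_scalar_mx -/S; have a0 : alpha i != 0 by rewrite gt_eqF.
rewrite blockB; apply/colP => r.
by move: (grad _ _) S => G S; rewrite !mxE; field.
Qed.

Lemma y_step k l : l \in Q ->
  subgradient (g1 l) (dual_direction k l - grad (g2 l) (y k l)) (y k.+1 l).
Proof.
move=> lQ; have [_ hprox _] := hiter k; have [_ [pg _ cg] _ _] := hg lQ.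
have b0 i : beta i != 0 by rewrite gt_eqF.
have := hprox l lQ; rewrite invmx_clique_diag// => /wprox_subgradient.
rewrite tr_clique_diag => /(_ erefl pg cg).
congr subgradient; rewrite /dual_direction /multiplier_estimate.
apply/colP => e; move: (grad _ _) => G.
rewrite !(mul_clique_diag, mxE); field; exact: b0.
Qed.

Lemma u_step k l e : l \in Q -> let i := entry_agent e in
  u k.+1 l e 0 = u k l e 0 + phi i * gamma i * residual k.+1 l e 0.
Proof.
move=> lQ; have [_ _ ->//] := hiter k.
by rewrite mxE -mulmxA !mul_clique_diag mulrA.
Qed.

Lemma multiplier_estimateE k l e :
  multiplier_estimate k l e 0 = u k l e 0 + gamma (entry_agent e) *
    (clique_vec (C l) (x k.+1) e 0 - y k l e 0).
Proof. by rewrite mxE mul_clique_diag !mxE. Qed.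

Lemma dual_directionE k l e : let i := entry_agent e in
  dual_direction k l e 0 = (beta i)^-1 * (y k l e 0 - y k.+1 l e 0) +
    (u k l e 0 + gamma i * (clique_vec (C l) (x k.+1) e 0 - y k l e 0)).
Proof. by rewrite /= mxE mul_clique_diag multiplier_estimateE !mxE. Qed.

Lemma residualE k l e :
  residual k l e 0 = clique_vec (C l) (x k) e 0 - y k l e 0.
Proof. by rewrite !mxE. Qed.

(** Shaped like [pot] in [entry_descent]; summed over all coordinates it is the y and u part of
    V_(k+1). *)
Definition entry_potential k l (e : 'I_(#|C l| * d)) : R :=
  let i := entry_agent e in
  2^-1 * ((beta i)^-1 * (y k.+1 l e 0 - ys l e 0) ^+ 2
  + (u k.+1 l e 0 - us l e 0) ^+ 2 / (phi i * gamma i)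
  + ((beta i)^-1 - gamma i + Lg l) * (y k.+1 l e 0 - y k l e 0) ^+ 2
  + gamma i * (2 - phi i - eps i) * residual k.+1 l e 0 ^+ 2).

(** The weight p_i in V; [hx] says that it is at least [Lf i]. *)
Definition primal_weight i := (alpha i)^-1 - gamma i * #|agent_cliques C Q i|%:R.

(* [potential k] is V_(k+1): its last difference y^(k+1) - y^k exists from
   k = 0 on. *)
Definition potential k : R :=
  \sum_i primal_weight i / 2 *
     dot (block (x k.+1 - xs) i) (block (x k.+1 - xs) i)
  + \sum_(l in Q) \sum_e entry_potential k (l := l) e.

Lemma potential_ge0 k : 0 <= potential k.
Proof.
apply: addr_ge0.
  apply: sumr_ge0 => i _.
  have [_ _ [Lf0 _ _ _] _] := hf i; have := hx i.
  rewrite -lerBrDl => /(le_trans Lf0) w0.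
  by rewrite mulr_ge0 ?dot_ge0// divr_ge0.
apply: sumr_ge0 => l lQ; apply: sumr_ge0 => e _; rewrite /entry_potential.
set i := entry_agent e; have [_ _ [Lg0 _ _ _] _] := hg lQ.
have /andP[e0 e1] := heps i; have := hy i.
have := hphi i; have := hgamma i; have := hbeta i => b0 g0 p0 bg.
rewrite mulr_ge0 ?invr_ge0// !addr_ge0//.
- by apply: mulr_ge0; rewrite ?sqr_ge0 ?invr_ge0// ltW.
- by apply: mulr_ge0; rewrite ?sqr_ge0 ?invr_ge0// mulr_ge0// ltW.
- by apply: mulr_ge0; rewrite ?sqr_ge0// addr_ge0.
- by apply: mulr_ge0; rewrite ?sqr_ge0// mulr_ge0//; lra.
Qed.

Definition residual_energy k : R :=
  \sum_(l in Q) \sum_(e < #|C l| * d)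
    2^-1 * (eps (entry_agent e) * gamma (entry_agent e) * residual k l e 0 ^+ 2).

(** * One-step decrease of the potential *)

Context (hfeas : forall l, l \in Q -> clique_vec (C l) xs = ys l).
Context (hdom : in_domain Q f g xs ys).

(** Subgradients of [g1 l] at consecutive iterates are monotone; passing to [dual_direction] costs
    the increment of the gradient of [g2 l], bounded by Lipschitz continuity and Young's
    inequality. *)
Lemma dual_direction_monotone k l : l \in Q ->
  0 <= dot (dual_direction k.+1 l - dual_direction k l)
           (y k.+2 l - y k.+1 l)
       + (Lg l / 2 * dot (y k.+1 l - y k l) (y k.+1 l - y k l)
          + Lg l / 2 * dot (y k.+2 l - y k.+1 l) (y k.+2 l - y k.+1 l)).
Proof.
move=> lQ; have [_ _ [Lg0 _ _ lip] _] := hg lQ.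
have := subgradient_monotone (y_step k lQ) (y_step k.+1 lQ).
set s' := dual_direction k.+1 l; set s := dual_direction k l.
set G' := grad _ (y k.+1 l); set G := grad _ (y k l).
set v := y k.+2 l - _; set w := _ - y k l => mono.
have -> : s' - s = (s' - G' - (s - G)) + (G' - G).
  by apply/colP => e; rewrite !mxE; ring.
rewrite dotDl -addrA addr_ge0//.
have := cauchy_schwarz (- (G' - G)) v; rewrite dotNl => cs.
have hG : enorm (- (G' - G)) <= Lg l * enorm w.
  by rewrite enormN; exact: lip.
have := ler_wpM2r (enorm_ge0 v) hG.
have : 0 <= Lg l * (enorm v - enorm w) ^+ 2 by rewrite mulr_ge0 ?sqr_ge0.
rewrite -(sqr_enorm v) -(sqr_enorm w); nra.
Qed.

(** [entry_descent] is summed over coordinates; the gap between the two sides is at least the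
    nonnegative quantity of [dual_direction_monotone]. *)
Lemma clique_descent k l : l \in Q ->
  dot (us l) (residual k.+2 l)
  - dot (multiplier_estimate k.+1 l) (clique_vec (C l) (x k.+2 - xs))
  + dot (dual_direction k.+1 l) (y k.+2 l - ys l)
  + Lg l / 2 * dot (y k.+2 l - y k.+1 l) (y k.+2 l - y k.+1 l)
  + \sum_e 2^-1 * (eps (entry_agent e) * gamma (entry_agent e) *
                   residual k.+2 l e 0 ^+ 2)
  <= \sum_e entry_potential k (l := l) e - \sum_e entry_potential k.+1 (l := l) e.
Proof.
move=> lQ; have mono := dual_direction_monotone k lQ.
rewrite -subr_ge0; apply: (le_trans mono); rewrite -subr_ge0.
rewrite !dotE !mulr_sumr -!sumrN -!big_split /= -sumrN -!big_split /=.
rewrite subr_ge0; apply: ler_sum => e _.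
have BE (v w : 'cV[R]_(#|C l| * d)) : (v - w) e 0 = v e 0 - w e 0.
  by rewrite !mxE.
(* A coordinate [e] exists only if [d] is positive, which makes [hyg] applicable. *)
have d_gt0 : (0 < d)%N.
  by have := leq_ltn_trans (leq0n e) (ltn_ord e); rewrite muln_gt0 => /andP[].
have hL := hyg d_gt0 lQ (entry_agent_in e).
have u2E := u_step k.+1 e lQ; rewrite residualE in u2E.
have := entry_descent (y k l e 0) (y k.+1 l e 0) (residual k.+1 l e 0)
  (ys l e 0) (us l e 0) (hgamma _) (hphi _) (heps _) (hy _) hL u2E.
(* [dual_direction k] contains u^k, while [entry_descent] is stated with u^(k+1). *)
have uk := u_step k e lQ.
have {uk} uk : u k l e 0 = u k.+1 l e 0 - phi (entry_agent e) *
  gamma (entry_agent e) * residual k.+1 l e 0 by rewrite uk addrK.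
rewrite /entry_potential [(dual_direction _ _ - _) _ _]BE.
rewrite !dual_directionE !multiplier_estimateE !residualE !BE uk residualE.
rewrite clique_vecB (hfeas lQ) BE.
move=> /= descent; rewrite -subr_ge0 in descent; rewrite -subr_ge0.
apply: (le_trans descent).
rewrite le_eqVlt; apply/orP; left; apply/eqP => /=; ring.
Qed.

(** The x-step uses the multiplier with x^(k+1), [multiplier_estimate] the one with x^(k+2). Their
    difference, collected over the cliques of agent i, contributes gamma_i |Q^i| and lowers the
    weight 1/alpha_i to [primal_weight]. *)
Lemma primal_descent k :
  \sum_i fine (f i (block (x k.+2) i)) - \sum_i fine (f i (block xs i))
  + \sum_(l in Q) dot (multiplier_estimate k.+1 l) (clique_vec (C l) (x k.+2 - xs))
  <= \sum_i primal_weight i / 2 *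
       dot (block (x k.+1 - xs) i) (block (x k.+1 - xs) i)
     - \sum_i primal_weight i / 2 *
       dot (block (x k.+2 - xs) i) (block (x k.+2 - xs) i).
Proof.
pose v l := u k.+1 l + clique_diag d (C l) gamma *m
  (clique_vec (C l) (x k.+1) - y k.+1 l).
have vE l : multiplier_estimate k.+1 l = v l -
    clique_diag d (C l) gamma *m clique_vec (C l) (x k.+1 - x k.+2).
  apply/colP => e; rewrite clique_vecB !mulmxBr multiplier_estimateE.
  by rewrite !(mul_clique_diag, mxE); ring.
under [X in _ + X <= _]eq_bigr do rewrite vE dotDl dotNl.
rewrite sumrB -!sum_agent_cliques.
rewrite -!sumrB -!big_split /=; apply: ler_sum => i _.
have -> : \sum_(l in agent_cliques C Q i) agent_block
      (clique_diag d (C l) gamma *m clique_vec (C l) (x k.+1 - x k.+2)) i =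
    (gamma i * #|agent_cliques C Q i|%:R) *: block (x k.+1 - x k.+2) i.
  rewrite (eq_bigr (fun=> gamma i *: block (x k.+1 - x k.+2) i)); last first.
    by move=> l; rewrite inE => /andP[_ il]; rewrite agent_block_clique_diag.
  by rewrite sumr_const -scaler_nat scalerA mulrC.
have [_] := forward_backward_ineq (hf i) (x_step k.+1 i) (hdom.1 i).
rewrite -/(\sum_(l in agent_cliques C Q i) agent_block (v l) i).
set S := \sum_(l in _) _.
have -> : block (x k.+2) i - block (x k.+1) i = - block (x k.+1 - x k.+2) i.
  by rewrite blockB opprB.
have -> : block (x k.+1 - xs) i =
    block (x k.+1 - x k.+2) i + block (x k.+2 - xs) i.
  by rewrite !blockB addrA subrK.
(* Here |v1 + v2|^2 - |v2|^2 = |v1|^2 + 2 <v1, v2>; the smoothness term in |v1|^2 is absorbed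
   because [Lf i <= primal_weight i]. *)
rewrite -blockB; move: (block (x k.+1 - _) i) (block (x k.+2 - _) i) => v1 v2.
rewrite !(dotDl, dotDr, dotNl, dotNr, dotZl) opprK (dotC v2 v1).
have := dot_ge0 v1; have : Lf i <= primal_weight i.
  by rewrite lerBrDl.
rewrite /primal_weight; set c := gamma i * _ => pL v10.
have := mulr_ge0 _ v10; rewrite -subr_ge0 in pL => /(_ _ pL); nra.
Qed.

(** The pairings of [multiplier_estimate] with the primal error have opposite signs in the primal
    and dual estimates and cancel. The index starts at 2 because monotonicity compares two
    consecutive y-steps. *)
Lemma descent k :
  objective Q f g (x k.+2) (y k.+2) - objective Q f g xs ys
  + \sum_(l in Q) dot (us l) (residual k.+2 l) + residual_energy k.+2
  <= potential k - potential k.+1.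
Proof.
have dual_descent :
    \sum_(l in Q) (fine (g l (y k.+2 l)) - fine (g l (ys l))
      + dot (us l) (residual k.+2 l)
      - dot (multiplier_estimate k.+1 l) (clique_vec (C l) (x k.+2 - xs))
      + \sum_e 2^-1 * (eps (entry_agent e) * gamma (entry_agent e) *
                       residual k.+2 l e 0 ^+ 2))
    <= \sum_(l in Q) (\sum_e entry_potential k (l := l) e
       - \sum_e entry_potential k.+1 (l := l) e).
  apply: ler_sum => l lQ; have := clique_descent k lQ.
  have [_] := forward_backward_ineq (hg lQ) (y_step k.+1 lQ) (hdom.2 l lQ).
  lra.
have := primal_descent k; move: dual_descent.
rewrite /potential /objective /residual_energy !big_split /= !sumrN; lra.
Qed.

(** Starts at index 1: the initial values are arbitrary and may lie outside the domain. *)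
Lemma iterate_in_domain k : in_domain Q f g (x k.+1) (y k.+1).
Proof.
split=> [i|l lQ].
  by have [] := forward_backward_ineq (hf i) (x_step k i) (hdom.1 i).
by have [] := forward_backward_ineq (hg lQ) (y_step k lQ) (hdom.2 l lQ).
Qed.

(** * Limits of the residual and of the objective *)

Context (hopt : forall x y, in_domain Q f g x y ->
  objective Q f g xs ys <= objective Q f g x y +
    \sum_(l in Q) dot (us l) (clique_vec (C l) x - y l)).

Lemma energy_term_ge0 i (r : R) : 0 <= 2^-1 * (eps i * gamma i * r ^+ 2).
Proof.
have /andP[e0 _] := heps i; rewrite mulr_ge0 ?invr_ge0//.
by apply: mulr_ge0; rewrite ?sqr_ge0// mulr_ge0// ltW.
Qed.

Lemma residual_energy_ge0 k : 0 <= residual_energy k.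
Proof.
by apply: sumr_ge0 => l _; apply: sumr_ge0 => e _; exact: energy_term_ge0.
Qed.

Lemma residual_energy_le k :
  residual_energy k.+2 <= potential k - potential k.+1.
Proof. by have := hopt (iterate_in_domain k.+1); have := descent k; lra. Qed.

Lemma potential_diff_cvg0 :
  (potential k - potential k.+1) @[k --> \oo] --> (0 : R).
Proof.
have noninc : {homo potential : a b / (a <= b)%N >-> b <= a}.
  apply/nonincreasing_seqP => k; rewrite -subr_ge0.
  exact: le_trans (residual_energy_ge0 k.+2) (residual_energy_le k).
have /cvg_ex[p pp] : cvgn potential.
  apply: nonincreasing_is_cvgn => //.
  by exists 0 => _ [k _ <-]; exact: potential_ge0.
rewrite -(subrr p); apply: cvgB => //.
by have := pp; rewrite -(cvg_shiftS potential).
Qed.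

Lemma stack_residual_cvg0 :
  enorm (stack Q (residual k)) @[k --> \oo] --> (0 : R).
Proof.
(* A single constant above every 2 / (eps_i gamma_i), so that [c] times the energy bounds the
   squared residual. *)
pose c := \sum_i 2 / (eps i * gamma i).
have c_ge i : 2 / (eps i * gamma i) <= c.
  rewrite /c (bigD1 i)//= lerDl sumr_ge0// => j _.
  by have /andP[e0 _] := heps j; rewrite divr_ge0// mulr_ge0// ltW.
have bound k : dot (stack Q (residual k)) (stack Q (residual k))
    <= c * residual_energy k.
  rewrite dot_stack mulr_sumr; apply: ler_sum => l lQ.
  rewrite dotE mulr_sumr; apply: ler_sum => e _.
  apply: le_trans (ler_wpM2r (energy_term_ge0 _ _) (c_ge (entry_agent e))).
  have /andP[e0 _] := heps (entry_agent e).
  rewrite le_eqVlt; apply/orP; left; apply/eqP; field.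
  by rewrite !gt_eqF.
have c0 : 0 <= c.
  apply: sumr_ge0 => j _; have /andP[e0 _] := heps j.
  by rewrite divr_ge0// mulr_ge0// ltW.
(* The energy is bounded by a drop of the potential from index 2 on. *)
rewrite -(cvg_shiftn 2).
apply: (@squeeze_cvgr _ _ _ _ (cst 0)
  (fun k => Num.sqrt (c * (potential k - potential k.+1)))).
- near=> k; rewrite enorm_ge0/= addn2 /enorm ler_sqrt; last first.
    rewrite mulr_ge0//.
    exact: le_trans (residual_energy_ge0 k.+2) (residual_energy_le k).
  by rewrite (le_trans (bound _))// ler_wpM2l// residual_energy_le.
- exact: cvg_cst.
have W0 : (c * (potential k - potential k.+1)) @[k --> \oo] --> c * 0.
  by apply: cvgM; [exact: cvg_cst | exact: potential_diff_cvg0].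
have := continuous_cvg _ (@sqrt_continuous R (c * 0)) W0.
by rewrite mulr0 sqrtr0; apply.
Unshelve. all: by end_near.
Qed.

(** The gap is squeezed between [hopt] and [descent], both up to the pairing of [us] with the
    residual, which tends to 0 by Cauchy-Schwarz. *)
Lemma objective_cvg :
  objective Q f g (x k) (y k) @[k --> \oo] --> objective Q f g xs ys.
Proof.
rewrite -(cvg_shiftn 2).
pose s k := enorm (stack Q us) * enorm (stack Q (residual (k + 2))).
have s0 : s k @[k --> \oo] --> (0 : R).
  rewrite -[X in _ --> X](mulr0 (enorm (stack Q us))).
  apply: cvgM; first exact: cvg_cst.
  rewrite (cvg_shiftn 2 (fun k => enorm (stack Q (residual k)))).
  exact: stack_residual_cvg0.
have lo : (objective Q f g xs ys - s k) @[k --> \oo] --> objective Q f g xs ys.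
  by rewrite -[X in _ --> X]subr0; apply: cvgB => //; exact: cvg_cst.
have hi : (objective Q f g xs ys + (potential k - potential k.+1) + s k)
    @[k --> \oo] --> objective Q f g xs ys.
  rewrite -[X in _ --> X]addr0 -[X in _ --> X + _]addr0.
  by apply: cvgD => //; apply: cvgD; [exact: cvg_cst | exact: potential_diff_cvg0].
apply: squeeze_cvgr lo hi; near=> k; rewrite /= /s !addn2.
have := hopt (iterate_in_domain k.+1); rewrite -/(residual _ _).
have := descent k; have := residual_energy_ge0 k.+2.
have := normr_dot_le (stack Q us) (stack Q (residual k.+2)).
rewrite dot_stack ler_norml => /andP[? ?] ? ? ?; apply/andP; split; lra.
Unshelve. all: by end_near.
Qed.

End FLiP_descent.

(** * Reduction of CL-ADMM to CL-FLiP-ADMM, and the conclusion *)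

Lemma grad_eq0 (R : realType) m (h : 'cV[R]_m -> R) z :
  (forall w, h w = 0) -> grad h z = 0.
Proof.
move=> h0; have -> : h = cst 0 by apply/funext => w; rewrite h0.
by apply/colP => j; rewrite !mxE derive_cst.
Qed.

Lemma CL_ADMM_FLiP (R : realType) (n q d : nat) (C : 'I_q -> {set 'I_n})
    (Q : {set 'I_q}) (f f1 : 'I_n -> 'cV[R]_d -> \bar R)
    (f2 : 'I_n -> 'cV[R]_d -> R)
    (g g1 : forall l : 'I_q, 'cV[R]_(#|C l| * d) -> \bar R)
    (g2 : forall l : 'I_q, 'cV[R]_(#|C l| * d) -> R)
    (alpha beta gamma phi : 'I_n -> R) (x : nat -> 'cV[R]_(n * d))
    (y u : nat -> forall l : 'I_q, 'cV[R]_(#|C l| * d)) :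
  (forall i z, f2 i z = 0 /\ f1 i z = f i z) ->
  (forall l z, l \in Q -> g2 l z = 0 /\ g1 l z = g l z) ->
  CL_ADMM Q f g alpha beta gamma phi x y u ->
  CL_FLiP_ADMM Q f1 f2 g1 g2 alpha beta gamma phi x y u.
Proof.
move=> hf hg iter Gamma Phi D k; have [px py pu] := iter k; split=> [i|l lQ|//].
  rewrite grad_eq0 => [|w]; last by have [] := hf i w.
  have -> : f1 i = f i by apply/funext => w; have [] := hf i w.
  by rewrite add0r.
rewrite grad_eq0 => [|w]; last by have [] := hg l w lQ.
have -> : g1 l = g l by apply/funext => w; have [] := hg l w lQ.
by rewrite add0r; exact: py.
Qed.

Theorem theorem2 (R : realType) (n d q : nat)
  (e : rel 'I_n) (he : symmetric e)
  (C : 'I_q -> {set 'I_n}) (hC : enumerates_cliques e C)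
  (Q : {set 'I_q})
  (f f1 : 'I_n -> 'cV[R]_d -> \bar R) (f2 : 'I_n -> 'cV[R]_d -> R)
  (g g1 : forall l : 'I_q, 'cV[R]_(#|C l| * d) -> \bar R)
  (g2 : forall l : 'I_q, 'cV[R]_(#|C l| * d) -> R)
  (Lf : 'I_n -> R) (Lg : 'I_q -> R)
  (alpha beta gamma phi : 'I_n -> R)
  (halpha : forall i, 0 < alpha i) (hbeta : forall i, 0 < beta i)
  (hgamma : forall i, 0 < gamma i) (hphi : forall i, 0 < phi i)
  (hf : forall i, ccp_split (Lf i) (f i) (f1 i) (f2 i))
  (hg : forall l, l \in Q -> ccp_split (Lg l) (g l) (g1 l) (g2 l))
  (x : nat -> 'cV[R]_(n * d))
  (y u : nat -> forall l : 'I_q, 'cV[R]_(#|C l| * d))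
  (hiter : CL_FLiP_ADMM Q f1 f2 g1 g2 alpha beta gamma phi x y u \/
     [/\ forall i z, f2 i z = 0 /\ f1 i z = f i z,
         forall l z, l \in Q -> g2 l z = 0 /\ g1 l z = g l z,
         forall i, Lf i = 0,
         forall l, l \in Q -> Lg l = 0
       & CL_ADMM Q f g alpha beta gamma phi x y u])
  (xs : 'cV[R]_(n * d)) (ys us : forall l : 'I_q, 'cV[R]_(#|C l| * d))
  (hsaddle : saddle_point Q f g xs ys us)
  (eps : 'I_n -> R) (heps : forall i, 0 < eps i < 2 - phi i)
  (hx : forall i,
     (alpha i)^-1 >= gamma i * #|agent_cliques C Q i|%:R + Lf i)
  (hy : forall i, (beta i)^-1 - gamma i >= 0)
  (hyg : forall i,
     loewner_ge
       ((gamma i * (1 - (1 - phi i) ^+ 2 / (2 - phi i - eps i))) *: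
          (1%:M : 'M[R]_d) + ((beta i)^-1 - gamma i) *: (1%:M : 'M[R]_d))
       ((3 * \big[Num.max/0]_(l in agent_cliques C Q i) Lg l) *:
          (1%:M : 'M[R]_d))) :
  ((Fsum f (x k) + Gsum Q g (y k))%E @[k --> \oo]
     --> (Fsum f xs + Gsum Q g ys)%E) /\
  (stack_mx R d C Q *m x k - stack Q (y k) @[k --> \oo]
     --> (0 : 'cV[R]_(\sum_(j < #|Q|) #|C (enum_val j)| * d))).
Proof.
have iter : CL_FLiP_ADMM Q f1 f2 g1 g2 alpha beta gamma phi x y u.
  case: hiter => // -[f20 g20 _ _]; exact: CL_ADMM_FLiP.
have hLg i l : (0 < d)%N -> l \in Q -> i \in C l ->
    3 * Lg l <= gamma i * (1 - (1 - phi i) ^+ 2 / (2 - phi i - eps i))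
                + ((beta i)^-1 - gamma i).
  (* Testing the matrix inequality on the first basis vector extracts the scalar one; the maximum
     over the cliques of [i] dominates [Lg l]. *)
  move=> d0 lQ il; have [_ /(_ (delta_mx (Ordinal d0) 0))] := hyg i.
  rewrite -scalerDl -scalerBl -scalemxAr mulmx1 -scalemxAl mxE.
  rewrite trmx_delta mul_delta_mx mxE !eqxx mulr1 subr_ge0.
  apply: le_trans; rewrite ler_pM2l//.
  by apply: le_bigmax_cond; rewrite inE lQ.
have pf i : proper_fun (f i) by have [[]] := hf i.
have pg l : l \in Q -> proper_fun (g l) by move=> /hg[[]].
have [dom feas opt] := saddle_pointP pf pg hsaddle.
split.
  (* The objective may be infinite at index 0, so the sequence is shifted by one before it is read
     in the reals. *)
  rewrite -(cvg_shiftn 1) (FGsum_fin dom).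
  have -> : (fun k => (Fsum f (x (k + 1)%N) + Gsum Q g (y (k + 1)%N))%E) =
      EFin \o (fun k => objective Q f g (x (k + 1)%N) (y (k + 1)%N)).
    apply/funext => k; rewrite /= addn1 FGsum_fin//.
    exact: (iterate_in_domain halpha hbeta hf hg iter dom).
  have obj := objective_cvg halpha hbeta hgamma hphi hf hg iter heps hx hy hLg
    feas dom opt.
  by rewrite -(cvg_shiftn 1) in obj; exact: (cvg_app EFin obj).
apply/cvgr0Pnorm_lt => r r0; near=> k; rewrite stack_residual.
apply: le_lt_trans (normr_le_enorm _) _.
apply: le_lt_trans (ler_norm _) _; near: k.
apply: cvgr0_norm_lt r0.
exact: (stack_residual_cvg0 halpha hbeta hgamma hphi hf hg iter heps hx hy hLg
  feas dom opt).
Unshelve. all: by end_near.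
Qed.
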